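(* For every integer $k \geq 1$, $$\zeta(2k) = \frac{\pi^{2k}}{2}\,\frac{P_k(k)}{\prod_{i=1}^{k}(2i+1)!!}.$$
   Context: $\zeta(2k)=\sum_{n\ge 1} n^{-2k}$ is the Riemann zeta function, and $(2i+1)!!=\prod_{j=1}^{i}(2j+1)$. The polynomials $P_k(x)$, $k\ge 1$, are defined recursively by $P_1(x)=1$ and, for $k\ge 1$, $$P_{k+1}(x) = \frac{P_k(k)\prod_{i=1}^{k}(2x-2k+2i+1)-\left(\prod_{i=1}^{k}(2i+1)\right)P_k(x)}{2x-2k};$$ this is a polynomial because the numerator vanishes at $x=k$ (the quotient is taken as polynomials in $x$). *)

(* Defs.v *)
From HB Require Import structures.
From mathcomp Require Import all_boot all_order all_algebra.
From mathcomp Require Import all_classical all_reals all_analysis.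
From mathcomp Require Import ring lra.

Set Implicit Arguments.
Unset Strict Implicit.
Unset Printing Implicit Defensive.

Import Order.TTheory GRing.Theory Num.Theory.
Import numFieldNormedType.Exports.

Local Open Scope ring_scope.

(* The sum of (n+1)^(-s) over n >= 0. It is used here only at s = 2k with
   k >= 1, where the series converges by is_cvg_zeta. *)
Definition zeta (R : realType) (s : R) : R := limn (series (riemannR s)).

(* (2i+1)!! *)
Definition odd_dfact (i : nat) : nat := (\prod_(1 <= j < i.+1) (2 * j + 1))%N.

(* One step of the recursion, from p = P_k to P_(k+1). The operator %/ is
   Euclidean division of polynomials; the division is exact by zetaP_recE. *)
Definition zetaP_step (F : numFieldType) (k : nat) (p : {poly F}) : {poly F} :=
  (p.[k%:R] *:
     \prod_(1 <= i < k.+1) (2 *: 'X - (2 * k)%:R%:P + (2 * i + 1)%:R%:P)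
   - (\prod_(1 <= i < k.+1) (2 * i + 1)%:R) *: p)
  %/ (2 *: 'X - (2 * k)%:R%:P).

(* The sequence starts at k = 1; the value at k = 0 is arbitrary. *)
Fixpoint zetaP (F : numFieldType) (k : nat) : {poly F} :=
  match k with
  | 0%N => 0
  | 1%N => 1
  | k'.+1 => zetaP_step k' (zetaP F k')
  end.

Lemma zetaP_recE (F : numFieldType) (k : nat) : (1 <= k)%N ->
  zetaP F k.+1 * (2 *: 'X - (2 * k)%:R%:P) =
  (zetaP F k).[k%:R] *:
     \prod_(1 <= i < k.+1) (2 *: 'X - (2 * k)%:R%:P + (2 * i + 1)%:R%:P)
  - (\prod_(1 <= i < k.+1) (2 * i + 1)%:R) *: zetaP F k.
Proof.
move=> k1; have -> : zetaP F k.+1 = zetaP_step k (zetaP F k) by case: k k1.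
move: (zetaP F k) => p; rewrite /zetaP_step divpK //.
have -> : 2 *: 'X - (2 * k)%:R%:P = 2 *: ('X - k%:R%:P) :> {poly F}.
  by rewrite scalerBr natrM polyCM mul_polyC.
rewrite dvdpZl ?pnatr_eq0 // dvdp_XsubCl rootE.
rewrite hornerD hornerN !hornerZ horner_prod mulrC subr_eq0.
apply/eqP; congr (_ * _); apply: eq_bigr => i _.
by rewrite hornerD hornerZ hornerXsubC subrr mulr0 add0r hornerC.
Qed.

Lemma is_cvg_zeta (R : realType) (s : R) : 2 <= s -> cvgn (series (riemannR s)).
Proof.
move=> s2; have s0 : 0 <= s by rewrite (le_trans _ s2).
have incr n : series (riemannR s) n <= series (riemannR s) n.+1.
  by rewrite seriesSr lerDl ltW// riemannR_gt0.
apply: nondecreasing_is_cvgn; first exact/nondecreasing_seqP.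
have bnd n : series (riemannR s) n.+1 <= 2 - n.+1%:R^-1.
  elim: n => [|n IH].
    rewrite /series /= big_nat1 /riemannR powR1 !invr1; lra.
  rewrite seriesSr (le_trans (lerD IH (lexx _)))//= -addrA lerD2l.
  have n1 : (0 : R) < n.+1%:R by rewrite ltr0n.
  have n2 : (0 : R) < n.+2%:R by rewrite ltr0n.
  have le2 : riemannR s n.+1 <= (n.+2%:R ^+ 2)^-1.
    rewrite /riemannR lef_pV2 ?posrE ?exprn_gt0 ?powR_gt0//.
    by rewrite -powR_mulrn// ler_powR// ler1n.
  have lt2 : (n.+2%:R ^+ 2)^-1 <= n.+1%:R^-1 - n.+2%:R^-1 :> R.
    have -> : n.+1%:R^-1 - n.+2%:R^-1 = (n.+1%:R * n.+2%:R)^-1 :> R.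
      rewrite -[n.+2]addn1 natrD in n2 *; field; lra.
    rewrite lef_pV2 ?posrE ?exprn_gt0 ?mulr_gt0// expr2 ler_wpM2r// ?ltW//.
    by rewrite ltr_nat.
  by rewrite addrC lerBlDr (le_trans le2)// addrC.
exists 2 => _ [n _ <-]; apply: le_trans (incr n) (le_trans (bnd n) _).
by rewrite gerBl invr_ge0.
Qed.

(* Main.v *)
Require Import Defs.
From HB Require Import structures.
From mathcomp Require Import all_boot all_order all_algebra.
From mathcomp Require Import all_classical all_reals all_analysis.
From mathcomp Require Import ring lra zify.

Import Order.TTheory GRing.Theory Num.Theory.
Import numFieldNormedType.Exports.

Local Open Scope ring_scope.

(** Write a_k for the ratio P_k(k) / (3!! 5!! ... (2k+1)!!) and z_k for
2 zeta(2k) / pi^(2k); the claim is a_k = z_k. Both sequences satisfy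

  sum_(1 <= k <= n) (-1)^(k-1) a_k / (2(n-k)+1)! = 2n / (2n+1)!,   n >= 1,

which is x cot x = 1 - sum_k a_k x^(2k) multiplied by sin x, read coefficient
by coefficient. Such a triangular system has only one solution
([convolution_inj]).

For a_k, the recursion defining P_(k+1) is evaluated at x = n: there the
product in it is a quotient of double factorials, and after division by
(3!! ... (2k-1)!!) (2n+1)!! (2n-2k)!! the recursion becomes
r_k = a_k / (2(n-k)+1)! - r_(k+1). Unfolding it from r_1, where P_1 = 1, to
r_n = a_n gives the alternating sum ([zetaP_expansion], [zetaP_ratio_convolution]).

For z_k, the proof is Cauchy's, at a finite level. With N = 2M+1, sin(N x) is
cos^N x tan x times a polynomial in tan^2 x with coefficients
(-1)^j C(N,2j+1) ([multiple_angle]); its M roots are the numbers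
tan^2(k pi / N) with 1 <= k <= M ([sin_poly_factor]). Newton's identities then
relate the power sums of cot^2(k pi / N) to binomial coefficients
([binomial_cot_newton]). Dividing by N^(2n+1) and letting M grow, C(N,j) / N^j
tends to 1/j! ([cvg_binomial_ratio]), and the power sums, divided by N^(2j),
tend to zeta(2j) / pi^(2j) because cot^2 x <= 1/x^2 <= 1 + cot^2 x
([cvg_cot_power_sum]). *)

(** * The values of the polynomials *)

(** This identifies the two sequences of the theorem: each of them solves the
triangular system whose weights are the coefficients 1/(2m+1)! of
(sin x)/x. *)
Lemma convolution_inj (F : fieldType) (w u v : nat -> F) : w 0%N != 0 ->
  (forall n, \sum_(i < n.+1) u i * w (n - i)%N =
             \sum_(i < n.+1) v i * w (n - i)%N) ->
  forall n, u n = v n.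
Proof.
move=> w0 uv n; elim/ltn_ind: n => n IH.
have := uv n; rewrite !big_ord_recr /= subnn.
under eq_bigr => i _ do rewrite IH ?ltn_ord//.
by move/addrI/(mulIf w0).
Qed.

Lemma odd_dfactS i : odd_dfact i.+1 = (odd_dfact i * (2 * i.+1 + 1))%N.
Proof. by rewrite /odd_dfact big_nat_recr. Qed.

Lemma odd_dfact_gt0 i : (0 < odd_dfact i)%N.
Proof.
elim: i => [|i IH]; first by rewrite /odd_dfact big_geq.
by rewrite odd_dfactS muln_gt0 IH addn1.
Qed.

Lemma odd_dfact_neq0 (F : numFieldType) i : (odd_dfact i)%:R != 0 :> F.
Proof. by rewrite pnatr_eq0 -lt0n odd_dfact_gt0. Qed.

Lemma odd_dfactD k d :
  (odd_dfact d * \prod_(1 <= i < k.+1) (2 * d + (2 * i + 1)))%N =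
  odd_dfact (k + d).
Proof.
elim: k => [|k IH]; first by rewrite big_geq// muln1.
rewrite big_nat_recr//= mulnA IH addSn odd_dfactS; congr (_ * _)%N; lia.
Qed.

Lemma fact_odd d : ((2 * d + 1)`! = odd_dfact d * (2 ^ d * d`!))%N.
Proof.
elim: d => [|d IH]; first by rewrite /odd_dfact big_geq.
have -> : (2 * d.+1 + 1 = (2 * d + 1).+2)%N by lia.
rewrite !factS IH odd_dfactS expnS; nia.
Qed.

Definition zetaP_ratio (F : numFieldType) (k : nat) : F :=
  (zetaP F k).[k%:R] / \prod_(1 <= i < k.+1) (odd_dfact i)%:R.

Section Algebra.
Variable F : numFieldType.

(** At x = k + d the linear factors of the recursion are the odd numbers
2d+3, ..., 2(k+d)+1, so that their product is (2(k+d)+1)!! / (2d+1)!!. *)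
Lemma zetaP_rec_horner k d : (0 < k)%N ->
  (zetaP F k.+1).[(k + d)%:R] * (2 * d)%:R =
  (zetaP F k).[k%:R] * (odd_dfact (k + d))%:R / (odd_dfact d)%:R
  - (odd_dfact k)%:R * (zetaP F k).[(k + d)%:R].
Proof.
move=> k0; have /(congr1 (fun p => p.[(k + d)%:R])) := zetaP_recE F k0.
have E : (2 *: 'X - (2 * k)%:R%:P).[(k + d)%:R] = (2 * d)%:R :> F.
  rewrite !hornerE !natrM natrD; ring.
rewrite hornerM E => ->; rewrite hornerD hornerN !hornerZ horner_prod.
congr (_ - _); last by rewrite natr_prod.
rewrite -mulrA; congr (_ * _); rewrite -odd_dfactD [in RHS]natrM mulrAC mulfV.
  rewrite mul1r natr_prod; apply: eq_bigr => i _.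
  by rewrite hornerD E hornerC -natrD.
exact: odd_dfact_neq0.
Qed.

(** The denominator on the left is the product of (2i+1)!! for i < k, times
(2n+1)!! (2n-2k)!! with n = k + d. This normalization is the one which turns
the recursion into r_k = a_k / (2d+1)! - r_(k+1), since
(2d+1)! = (2d+1)!! (2d)!!; unfolding it down to d = 0 yields the sum. *)
Lemma zetaP_expansion d k : (0 < k)%N ->
  (zetaP F k).[(k + d)%:R] /
    (\prod_(1 <= i < k) (odd_dfact i)%:R * (odd_dfact (k + d))%:R
     * (2 ^ d * d`!)%:R) =
  \sum_(i < d.+1) (-1) ^+ i * zetaP_ratio F (k + i) / ((2 * (d - i) + 1)`!)%:R.
Proof.
elim: d k => [|d IH] k k0.
  rewrite big_ord1 addn0 fact0 muln1 expn0 /zetaP_ratio big_nat_recr//=.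
  by rewrite muln0 expr0 mul1r divr1 mulr1.
have nz := odd_dfact_neq0 F.
have nzp : \prod_(1 <= i < k) (odd_dfact i)%:R != 0 :> F.
  by rewrite prodf_seq_neq0; apply/allP => i _; rewrite nz.
have nz2 : (2 ^ d * d`!)%:R != 0 :> F.
  by rewrite pnatr_eq0 -lt0n muln_gt0 expn_gt0 fact_gt0.
rewrite big_ord_recl expr0 mul1r addn0 subn0.
rewrite (_ : \sum_(i < d.+1) _ = - \sum_(i < d.+1)
    (-1) ^+ i * zetaP_ratio F (k.+1 + i) / ((2 * (d - i) + 1)`!)%:R); last first.
  rewrite -sumrN; apply: eq_bigr => i _.
  by rewrite lift0 exprS mulN1r addnS -addSn subSS !mulNr.
rewrite -IH// (big_nat_recr k)//= addSnnS fact_odd /zetaP_ratio big_nat_recr//=.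
have -> : (2 ^ d.+1 * d.+1`! = 2 * d.+1 * (2 ^ d * d`!))%N.
  rewrite expnS factS; nia.
have nzK := nz k; have nzD := nz d.+1; have nzn := nz (k + d.+1)%N.
have nz2d : (2 * d.+1)%:R != 0 :> F by rewrite pnatr_eq0.
have := zetaP_rec_horner k d.+1 k0.
rewrite (natrM _ (odd_dfact _)) (natrM _ (2 * d.+1)).
move: (zetaP F k).[(k + _)%:R] (zetaP F k).[k%:R] (zetaP F _.+1).[_] => a b c.
move: (odd_dfact (k + _))%:R (odd_dfact k)%:R (odd_dfact d.+1)%:R nzK nzD nzn nz2d.
move: (2 * _)%:R (2 ^ d * _)%:R (\prod_(_ <= _ < _) _) nz2 nzp.
move=> w y p y0 p0 Dn Dk Dd Dk0 Dd0 Dn0 w0 /(canRL (mulfK w0)) ->.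
by field; rewrite Dk0 Dd0 Dn0 w0 y0 p0.
Qed.

End Algebra.

(** The case k = 1 of the expansion: P_1 = 1 makes the left-hand side explicit. *)
Lemma zetaP_ratio_convolution (F : numFieldType) n :
  \sum_(i < n.+1) (-1) ^+ i * zetaP_ratio F i.+1 * ((2 * (n - i) + 1)`!)%:R^-1 =
  2 * n.+1%:R / ((2 * n.+1 + 1)`!)%:R.
Proof.
rewrite -(zetaP_expansion F n 1 (ltnSn 0)) hornerC big_geq// !mul1r.
have nz := odd_dfact_neq0 F.
have nz2 : (2 ^ n * n`!)%:R != 0 :> F.
  by rewrite pnatr_eq0 -lt0n muln_gt0 expn_gt0 fact_gt0.
rewrite fact_odd (_ : 2 ^ n.+1 * n.+1`! = 2 * n.+1 * (2 ^ n * n`!))%N.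
  rewrite !(natrM _ (odd_dfact _)) !(natrM _ (2 * _)) (natrM _ 2 n.+1).
  have n0 : n.+1%:R != 0 :> F by rewrite pnatr_eq0.
  have := nz (1 + n)%N; move: (odd_dfact _)%:R (2 ^ n * _)%:R n.+1%:R nz2 n0.
  by move=> D y w y0 w0 D0; field; rewrite D0 y0 w0.
rewrite expnS factS; nia.
Qed.

(** * Newton's identities for reciprocal roots *)

Section Newton.
Variable R : comNzRingType.
Implicit Types (u : R) (s : seq R) (q : {poly R}).

Lemma coef_1subX_mul u q n :
  ((1 - u *: 'X) * q)`_n = q`_n - u * (if n is m.+1 then q`_m else 0).
Proof.
by rewrite mulrBl mul1r coefB -scalerAl coefZ coefXM; case: n.
Qed.

(** Division by 1 - u X is convolution with the geometric series of u. *)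
Lemma geometric_1subX u q n :
  \sum_(i < n.+1) u ^+ i * ((1 - u *: 'X) * q)`_(n - i) = q`_n.
Proof.
elim: n => [|n IH].
  by rewrite big_ord1 expr0 mul1r coef_1subX_mul mulr0 subr0.
rewrite big_ord_recl mul1r subn0 coef_1subX_mul -IH mulr_sumr.
rewrite -addrA [X in _ + X](_ : _ = 0) ?addr0// addrC -sumrB.
by apply: big1 => i _; rewrite lift0 subSS exprS mulrA subrr.
Qed.

(** This is the logarithmic derivative p' = - p * sum_i S_i X^i, where S_i is
the power sum of exponent i+1 of the reciprocal roots u. Adding a factor
1 - u X contributes the geometric series of u to the power sums, hence the
induction on s. *)
Lemma newton_reciprocal s c n :
  let p := c *: \prod_(u <- s) (1 - u *: 'X) in
  n.+1%:R * p`_n.+1 =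
  - \sum_(i < n.+1) (\sum_(u <- s) u ^+ i.+1) * p`_(n - i).
Proof.
rewrite /=; elim: s n => [|u s IH] n.
  rewrite big_nil coefZ coef1 !mulr0 big1 ?oppr0// => i _.
  by rewrite big_nil mul0r.
rewrite big_cons scalerAr; set q := c *: _ in IH *; set p := _ * q.
under eq_bigr => i _ do rewrite big_cons mulrDl exprS -mulrA.
rewrite big_split/= -mulr_sumr geometric_1subX.
have -> : \sum_(i < n.+1) (\sum_(v <- s) v ^+ i.+1) * p`_(n - i) =
  - (n.+1%:R * q`_n.+1) + u * (n%:R * q`_n).
  rewrite IH opprK; case: n => [|n].
    by rewrite !big_ord1 sub0n coef_1subX_mul mul0r !mulr0 subr0 addr0.
  rewrite IH big_ord_recr [in RHS]big_ord_recr/= subnn.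
  rewrite {2}/p coef_1subX_mul mulr0 subr0.
  rewrite addrAC; congr (_ + _).
  rewrite mulrN mulr_sumr -sumrB; apply: eq_bigr => i _.
  rewrite subSn; last by rewrite -ltnS.
  rewrite coef_1subX_mul; ring.
rewrite coef_1subX_mul -addn1 natrD; ring.
Qed.

End Newton.

(** * Multiple angles *)

Section MultipleAngle.
Variable R : realType.
Implicit Types x : R.

Definition cos_poly N : {poly R} :=
  \poly_(j < N.+1) ((-1) ^+ j *+ 'C(N, 2 * j)).
Definition sin_poly N : {poly R} :=
  \poly_(j < N.+1) ((-1) ^+ j *+ 'C(N, 2 * j + 1)).

Lemma coef_cos_poly N j : (cos_poly N)`_j = (-1) ^+ j *+ 'C(N, 2 * j).
Proof. by rewrite coef_poly; case: ltnP => // Nj; rewrite bin_small//; lia. Qed.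

Lemma coef_sin_poly N j : (sin_poly N)`_j = (-1) ^+ j *+ 'C(N, 2 * j + 1).
Proof. by rewrite coef_poly; case: ltnP => // Nj; rewrite bin_small//; lia. Qed.

Lemma sin_polyS N : sin_poly N.+1 = sin_poly N + cos_poly N.
Proof.
apply/polyP => j; rewrite coefD !coef_sin_poly coef_cos_poly addn1 binS.
by rewrite mulrnDr.
Qed.

Lemma cos_polyS N : cos_poly N.+1 = cos_poly N - 'X * sin_poly N.
Proof.
apply/polyP => j; rewrite coefB coefXM !coef_cos_poly.
case: j => [|j]; first by rewrite /= !bin0 subr0.
rewrite coef_sin_poly (_ : 2 * j.+1 = (2 * j + 1).+1)%N; last by lia.
by rewrite binS mulrnDr [X in _ + X *+ _]exprS mulN1r mulNrn.
Qed.

(** De Moivre's formula with cos^N x factored out. The addition formulas and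
Pascal's rule give the same recursion on both sides, which avoids complex
numbers. *)
Lemma multiple_angle N x : cos x != 0 ->
  cos (x *+ N) = cos x ^+ N * (cos_poly N).[tan x ^+ 2] /\
  sin (x *+ N) = cos x ^+ N * (tan x * (sin_poly N).[tan x ^+ 2]).
Proof.
move=> cx; have sE : sin x = cos x * tan x by rewrite /tan mulrC divfK.
elim: N => [|N [IHc IHs]].
  rewrite /cos_poly /sin_poly !poly_def !big_ord1 muln0 add0n !bin0n/=.
  by rewrite expr0 !mulr0n scale0r scale1r horner0 hornerC cos0 sin0 !mulr0 mulr1.
rewrite !mulrS cosD sinD IHc IHs cos_polyS sin_polyS sE.
rewrite !hornerD hornerN hornerM hornerX (exprS (cos x)).
by move: (tan x) => t; split; ring.
Qed.

End MultipleAngle.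

(** * Power sums of squared cotangents *)

Section SineRoots.
Variable R : realType.
Implicit Types x : R.

Lemma sin_natpi k : sin (pi *+ k) = 0 :> R.
Proof.
by rewrite -[pi *+ k]add0r (alternatingn (@sinDpi R)) sin0 mulr0.
Qed.

(** Indices are shifted: k < M stands for the angle (k+1) pi / (2M+1), in
agreement with the indexing of the terms of the zeta series. *)
Definition sin_angle M k : R := k.+1%:R * pi / (2 * M + 1)%:R.

Lemma sin_angle_itv M k : (k < M)%N -> 0 < sin_angle M k < pi / 2.
Proof.
move=> kM; rewrite /sin_angle; have p0 := pi_gt0 R.
have N0 : 0 < (2 * M + 1)%:R :> R by rewrite ltr0n addn1.
apply/andP; split; first by rewrite divr_gt0 ?mulr_gt0.
rewrite ltr_pdivrMr// mulrAC ltr_pdivlMr//.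
rewrite mulrAC mulrC ltr_pM2l// -natrM ltr_nat; lia.
Qed.

Lemma cos_gt0_itv x : 0 < x < pi / 2 -> 0 < cos x.
Proof.
move=> /andP[x0 xp]; apply: cos_gt0_pihalf; rewrite xp andbT.
by apply: lt_trans x0; rewrite oppr_lt0 divr_gt0// pi_gt0.
Qed.

Lemma tan_gt0 x : 0 < x < pi / 2 -> 0 < tan x.
Proof. by move=> xp; rewrite /tan divr_gt0 ?sin_gt0_pihalf ?cos_gt0_itv. Qed.

Definition sin_roots M : seq R := [seq tan (sin_angle M k) ^+ 2 | k <- iota 0 M].

Lemma sin_roots_uniq M : uniq (sin_roots M).
Proof.
rewrite map_inj_in_uniq ?iota_uniq// => i j; rewrite !mem_iota !add0n /=.
move=> iM jM /eqP; have ti := sin_angle_itv _ _ iM.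
have tj := sin_angle_itv _ _ jM.
rewrite eqrXn2 ?ltW ?tan_gt0// => /eqP/tan_inj.
have itv x : 0 < x < pi / 2 -> x \in `](- (pi / 2)), (pi / 2)[.
  move=> /andP[x0 xp]; rewrite in_itv/= xp andbT.
  by apply: lt_trans x0; rewrite oppr_lt0 divr_gt0// pi_gt0.
move=> /(_ (itv _ ti) (itv _ tj)) /divIf.
rewrite pnatr_eq0 addn1 => /(_ isT) /mulIf.
by rewrite gt_eqF ?pi_gt0// => /(_ isT) /eqP; rewrite eqr_nat => /eqP[].
Qed.

(** The sine of (2M+1) x vanishes at these angles, while cos x and tan x do not;
the remaining factor in the multiple-angle formula must vanish. *)
Lemma sin_roots_root M : all (root (sin_poly R (2 * M + 1))) (sin_roots M).
Proof.
apply/allP => _ /mapP[k + ->]; rewrite mem_iota /= add0n => kM.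
have xp := sin_angle_itv _ _ kM.
have c0 : cos (sin_angle M k) != 0 by rewrite gt_eqF// cos_gt0_itv.
have := (multiple_angle R (2 * M + 1) _ c0).2.
have -> : sin_angle M k *+ (2 * M + 1) = pi *+ k.+1.
  by rewrite -mulr_natr /sin_angle divfK ?mulr_natl// pnatr_eq0 addn1.
rewrite sin_natpi => /esym/eqP; rewrite mulf_eq0 expf_eq0.
by rewrite (negbTE c0) andbF mulf_eq0 gt_eqF ?tan_gt0.
Qed.

(** The polynomial has degree M and M distinct nonzero roots, so it splits. The
constant c is left implicit: Newton's identities are homogeneous in it. *)
Lemma sin_poly_factor M : exists c : R, sin_poly R (2 * M + 1) =
  c *: \prod_(u <- [seq (tan (sin_angle M k) ^+ 2)^-1 | k <- iota 0 M])
         (1 - u *: 'X).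
Proof.
have sz : size (sin_poly R (2 * M + 1)) = M.+1.
  apply/eqP; rewrite eqn_leq; apply/andP; split.
    apply/leq_sizeP => j Mj; rewrite coef_sin_poly bin_small//; lia.
  rewrite ltnNge; apply/negP => /leq_sizeP/(_ _ (leqnn _))/eqP.
  by rewrite coef_sin_poly binn mulr1n signr_eq0.
have := all_roots_prod_XsubC _ (sin_roots_root M) _.
rewrite size_map size_iota uniq_rootsE => /(_ sz (sin_roots_uniq M)) ->.
(* Each factor X - t is rewritten as (- t) (1 - X / t). *)
exists (lead_coef (sin_poly R (2 * M + 1)) *
  \prod_(k <- iota 0 M) (- tan (sin_angle M k) ^+ 2)).
rewrite -scalerA; congr (_ *: _); rewrite !big_map.
have : all (fun k => k < M)%N (iota 0 M).
  by apply/allP => k; rewrite mem_iota.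
elim: (iota 0 M) => [|k s IH] /=; first by rewrite !big_nil scale1r.
move=> /andP[kM /IH E]; rewrite !big_cons E -scalerAr (mulrC (- _)) -scalerA.
congr (_ *: _); rewrite scalerAl; congr (_ * _); rewrite scalerBr scalerA mulNr mulfV.
  by rewrite scaleN1r opprK alg_polyC polyCN addrC.
by rewrite expf_eq0/= gt_eqF// tan_gt0// sin_angle_itv.
Qed.

Lemma binomial_cot_newton M n :
  n.+1%:R * ((-1) ^+ n.+1 *+ 'C(2 * M + 1, 2 * n.+1 + 1)) =
  - \sum_(i < n.+1) (\sum_(0 <= k < M) (tan (sin_angle M k) ^- 2) ^+ i.+1) *
      ((-1) ^+ (n - i) *+ 'C(2 * M + 1, 2 * (n - i) + 1)) :> R.
Proof.
have [c E] := sin_poly_factor M; have /= := newton_reciprocal _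
  [seq (tan (sin_angle M k) ^+ 2)^-1 | k <- iota 0 M] c n.
rewrite -E coef_sin_poly => ->; congr (- _); apply: eq_bigr => i _.
by rewrite coef_sin_poly big_map /index_iota subn0.
Qed.

End SineRoots.

(** * Passage to the limit *)

Section Limits.
Local Open Scope classical_set_scope.
Variable R : realType.

Lemma sin_le_id (x : R) : 0 <= x -> sin x <= x.
Proof.
move=> x0.
have [|c _] := @MVT_segment R sin cos 0 x x0.
  exact/continuous_subspaceT/continuous_sin.
rewrite sin0 !subr0 => ->.
by rewrite ler_piMl// cos_le1.
Qed.

Lemma tan_ge_id (x : R) : 0 < x < pi / 2 -> x <= tan x.
Proof.
move=> /andP[x0 xp].
have cp y : 0 <= y <= x -> 0 < cos y.
  move=> /andP[y0 yx]; apply: cos_gt0_pihalf.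
  rewrite (le_lt_trans yx xp) andbT (lt_le_trans _ y0)// oppr_lt0.
  by rewrite divr_gt0// pi_gt0.
have [||c] := @MVT_segment R tan (fun y => cos y ^- 2) 0 x (ltW x0).
- move=> y; rewrite in_itv/= => /andP[y0 yx].
  by apply: is_derive_tan; rewrite gt_eqF// cp// !ltW.
- apply: continuous_in_subspaceT => y; rewrite inE/= in_itv/= => /cp cy.
  by apply: continuous_tan; rewrite gt_eqF.
rewrite in_itv/= tan0 !subr0 => /cp c0 ->.
apply: ler_peMl; first exact: ltW.
by rewrite invf_ge1 ?exprn_gt0// expr_le1// ?cos_le1// ltW.
Qed.

Lemma cot2_bounds (x : R) : 0 < x < pi / 2 ->
  tan x ^- 2 <= x ^- 2 <= tan x ^- 2 + 1.
Proof.
move=> xp; have t0 := tan_gt0 _ _ xp; have /andP[x0 _] := xp.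
have s0 := sin_gt0_pihalf xp; have c0 := cos_gt0_itv _ _ xp.
apply/andP; split.
  by rewrite lef_pV2 ?posrE ?exprn_gt0// lerXn2r ?nnegrE ?tan_ge_id ?ltW.
(* 1 + cot^2 = 1 / sin^2, so the upper bound amounts to sin x <= x. *)
have -> : tan x ^- 2 + 1 = sin x ^- 2.
  have := cos2Dsin2 x; rewrite /tan; move: (cos x) (sin x) c0 s0 => c s c0 s0 E.
  apply/eqP; rewrite -subr_eq0 -oppr_eq0; apply/eqP.
  transitivity ((1 - (c ^+ 2 + s ^+ 2)) / s ^+ 2); last by rewrite E subrr mul0r.
  by field; rewrite !gt_eqF.
by rewrite lef_pV2 ?posrE ?exprn_gt0// lerXn2r ?nnegrE ?sin_le_id ?ltW.
Qed.

Lemma expr_sub_le (x y : R) j : 0 <= y -> y <= x -> x <= 1 ->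
  x ^+ j - y ^+ j <= j%:R * (x - y).
Proof.
move=> y0 yx x1; elim: j => [|j IH]; first by rewrite mul0r subrr.
have xj : x ^+ j <= 1 by rewrite exprn_ile1// (le_trans y0).
have -> : x ^+ j.+1 - y ^+ j.+1 = x ^+ j * (x - y) + y * (x ^+ j - y ^+ j).
  by rewrite !exprS; ring.
rewrite -addn1 natrD mulrDl mul1r addrC lerD//.
  apply: le_trans IH; rewrite ler_piMl ?(le_trans yx)// subr_ge0.
  by rewrite lerXn2r// nnegrE (le_trans y0).
by rewrite ler_piMl// subr_ge0.
Qed.

Lemma cvg_odd_inv : ((2 * M + 1)%:R^-1 : R) @[M --> \oo] --> 0.
Proof.
apply: (@squeeze_cvgr _ _ _ _ (fun=> 0) (@harmonic R)) => //.
- near=> M; rewrite invr_ge0 ler0n /= lef_pV2 ?posrE ?ltr0n ?addn1//.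
  by rewrite ler_nat; lia.
- exact: cvg_cst.
- exact: cvg_harmonic.
Unshelve. all: by end_near. Qed.

Lemma cvg_binomial_ratio j :
  ('C(2 * M + 1, j)%:R / (2 * M + 1)%:R ^+ j : R) @[M --> \oo] --> (j`!%:R : R)^-1.
Proof.
elim: j => [|j IH].
  under eq_fun do rewrite bin0 expr0 divr1.
  by rewrite fact0 invr1; exact: cvg_cst.
rewrite (_ : (fun M => _) = fun M => ('C(2 * M + 1, j)%:R / (2 * M + 1)%:R ^+ j)
   * ((1 - j%:R * (2 * M + 1)%:R^-1) / j.+1%:R)).
  have -> : (j.+1`!%:R : R)^-1 = (j`!%:R)^-1 * ((1 - j%:R * 0) / j.+1%:R).
    by rewrite mulr0 subr0 mul1r factS mulnC natrM invfM.
  apply: cvgM => //; apply: cvgMr_tmp; apply: cvgB; first exact: cvg_cst.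
  apply: cvgMl_tmp; exact: cvg_odd_inv.
apply/funext => M; set N := (2 * M + 1)%N.
have N0 : N%:R != 0 :> R by rewrite pnatr_eq0 /N addn1.
have j0 : j.+1%:R != 0 :> R by rewrite pnatr_eq0.
have : j.+1%:R * 'C(N, j.+1)%:R = (N%:R - j%:R) * 'C(N, j)%:R :> R.
  have [jN|Nj] := leqP j N; first by rewrite -natrB// -!natrM mul_bin_left.
  by rewrite !bin_small ?mulr0// ltnW.
rewrite mulrC => /(canRL (mulfK j0)) ->.
rewrite exprS; move: (j.+1%:R) (N%:R) j0 N0 => J m J0 m0.
by field; rewrite J0 m0 expf_neq0.
Qed.

(** For x = (k+1) pi / N with N = 2M+1, the bounds on cot^2 x divided by N^2 put
cot^2 x / N^2 within 1 / N^2 of 1 / ((k+1) pi)^2, which is at most 1. Raising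
to the power j+1 multiplies this error by at most j+1, and the M < N errors
add up to at most (j+1) / N. *)
Lemma cvg_cot_power_sum j :
  ((\sum_(0 <= k < M) (tan (sin_angle R M k) ^- 2) ^+ j.+1) /
     (2 * M + 1)%:R ^+ (2 * j.+1)) @[M --> \oo] -->
  zeta ((2 * j.+1)%:R : R) / pi ^+ (2 * j.+1).
Proof.
set f := fun M => _.
pose g := fun M => series (riemannR (2 * j.+1)%:R) M / (pi : R) ^+ (2 * j.+1).
have gl : g M @[M --> \oo] --> zeta ((2 * j.+1)%:R : R) / pi ^+ (2 * j.+1).
  rewrite /g; apply: cvgMr_tmp.
  by apply: is_cvg_zeta; rewrite ler_nat; lia.
have p1 : 1 <= pi :> R by rewrite (le_trans _ (pi_ge2 R))// ler1n.
have gE M : g M = \sum_(0 <= k < M) ((k.+1%:R * pi) ^- 2) ^+ j.+1.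
  rewrite /g /series /= mulr_suml; apply: eq_bigr => k _.
  by rewrite /riemannR powR_mulrn// -invfM -exprMn exprM -exprVn.
have fg M : 0 <= g M - f M <= j.+1%:R * (2 * M + 1)%:R^-1.
  set N : R := (2 * M + 1)%:R; have N0 : 0 < N by rewrite ltr0n addn1.
  have fE : f M = \sum_(0 <= k < M) (tan (sin_angle R M k) ^- 2 / N ^+ 2) ^+ j.+1.
    by rewrite /f mulr_suml; apply: eq_bigr => k _; rewrite [in RHS]expr_div_n -(exprM N).
  have term k : (k < M)%N ->
      0 <= ((k.+1%:R * pi) ^- 2) ^+ j.+1 -
           (tan (sin_angle R M k) ^- 2 / N ^+ 2) ^+ j.+1 <= j.+1%:R * N ^- 2.
    move=> kM; have ap := sin_angle_itv R _ _ kM.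
    have := tan_gt0 _ _ ap; have := cot2_bounds _ ap.
    move: (tan (sin_angle R M k)) => t.
    rewrite /sin_angle -/N expr_div_n invf_div.
    set x := (k.+1%:R * pi) ^- 2; set y := t ^- 2 => /andP[yx xy] t0.
    have {}t0 : 0 <= y by rewrite invr_ge0 exprn_ge0// ltW.
    have N20 : 0 < N ^+ 2 by rewrite exprn_gt0.
    have y0 : 0 <= y / N ^+ 2 by rewrite divr_ge0// ltW.
    have yx' : y / N ^+ 2 <= x by rewrite ler_pdivrMr// mulrC.
    have x1 : x <= 1.
      rewrite invf_le1 ?exprn_gt0 ?mulr_gt0 ?ltr0n ?pi_gt0// exprn_ege1//.
      by rewrite mulr_ege1// ler1n.
    rewrite subr_ge0 lerXn2r ?nnegrE ?(le_trans y0)//=.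
    apply: le_trans (expr_sub_le _ _ _ y0 yx' x1) _.
    rewrite ler_wpM2l// lerBlDr (_ : _ + _ = (y + 1) / N ^+ 2).
      by rewrite ler_pdivlMr// mulrC.
    by rewrite mulrDl mul1r addrC.
  rewrite gE fE -sumrB big_nat_cond; apply/andP; split.
    by apply: sumr_ge0 => k /andP[/term/andP[]].
  apply: (@le_trans _ _ (\sum_(0 <= k < M) j.+1%:R * N ^- 2)).
    by rewrite [leRHS]big_nat_cond; apply: ler_sum => k /andP[/term/andP[]].
  rewrite sumr_const_nat subn0 -mulrnAr ler_wpM2l// -mulr_natl expr2 invfM mulrA.
  apply: ler_piMl; first by rewrite invr_ge0 ltW.
  rewrite ler_pdivrMr// mul1r ler_nat; lia.
have : (g M - f M) @[M --> \oo] --> 0.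
  apply: (@squeeze_cvgr _ _ _ _ (fun=> 0) (fun M => j.+1%:R * (2 * M + 1)%:R^-1)).
  - by near=> M; exact: fg.
  - exact: cvg_cst.
  - by rewrite -(mulr0 j.+1%:R); apply: cvgMl_tmp; exact: cvg_odd_inv.
move=> /(cvgB gl); rewrite subr0; apply: cvg_trans; apply: near_eq_cvg.
by near=> M => /=; rewrite opprB addrC subrK.
Unshelve. all: by end_near. Qed.

(** The limit, as M grows, of the Newton identity for the cotangents divided by
(2M+1)^(2n+3). *)
Lemma zeta_convolution n :
  \sum_(i < n.+1) (-1) ^+ i *
     (2 * (zeta ((2 * i.+1)%:R : R) / pi ^+ (2 * i.+1))) *
     ((2 * (n - i) + 1)`!)%:R^-1 =
  2 * n.+1%:R / ((2 * n.+1 + 1)`!)%:R.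
Proof.
pose Z i : R := zeta ((2 * i.+1)%:R : R) / pi ^+ (2 * i.+1).
pose b M j : R := 'C(2 * M + 1, j)%:R / (2 * M + 1)%:R ^+ j.
pose S M i : R := (\sum_(0 <= k < M) (tan (sin_angle R M k) ^- 2) ^+ i.+1) /
  (2 * M + 1)%:R ^+ (2 * i.+1).
have finite M : n.+1%:R * b M (2 * n.+1 + 1)%N =
    \sum_(i < n.+1) (-1) ^+ i * S M i * b M (2 * (n - i) + 1)%N.
  have N0 : (2 * M + 1)%:R != 0 :> R by rewrite pnatr_eq0 addn1.
  apply: (@mulfI _ ((-1) ^+ n.+1 * (2 * M + 1)%:R ^+ (2 * n.+1 + 1))).
    by rewrite mulf_neq0 ?signr_eq0 ?expf_neq0.
  transitivity (n.+1%:R * ((-1) ^+ n.+1 *+ 'C(2 * M + 1, 2 * n.+1 + 1)) : R).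
    by rewrite /b -mulr_natr; field; rewrite expf_neq0.
  rewrite binomial_cot_newton mulr_sumr -sumrN; apply: eq_bigr => i _.
  have iN : (i <= n)%N by rewrite -ltnS.
  (* Written this way, the sign cancels the factor (-1)^(n+1) put in front. *)
  have sE : (-1) ^+ (n - i) = - ((-1) ^+ n.+1 * (-1) ^+ i) :> R.
    move/subnK: iN.
    move: (nat_of_ord i) => j; move: (n - j)%N => m <-.
    by rewrite exprS exprD mulN1r mulNr opprK -mulrA -expr2 sqrr_sign mulr1.
  rewrite /b /S -mulr_natr sE.
  rewrite (_ : 2 * n.+1 + 1 = 2 * i.+1 + (2 * (n - i) + 1))%N; last by lia.
  rewrite [(2 * M + 1)%:R ^+ (_ + _)]exprD.
  have := expf_neq0 (2 * i.+1) N0; have := expf_neq0 (2 * (n - i) + 1) N0.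
  move: (_ ^+ (2 * (n - i) + 1)) (_ ^+ (2 * i.+1)) (_ ^+ n.+1) => x y z x0 y0.
  by field; rewrite x0 y0.
have L : (n.+1%:R * b M (2 * n.+1 + 1)%N) @[M --> \oo] -->
    (n.+1%:R / ((2 * n.+1 + 1)`!)%:R : R).
  by apply: cvgMl_tmp; exact: cvg_binomial_ratio.
have : (\sum_(i < n.+1) (-1) ^+ i * S M i * b M (2 * (n - i) + 1)%N)
    @[M --> \oo] -->
    (\sum_(i < n.+1) (-1) ^+ i * Z i * ((2 * (n - i) + 1)`!)%:R^-1 : R).
  apply: cvg_big => [|i _]; first exact: add_continuous.
  apply: cvgM; last exact: cvg_binomial_ratio.
  by apply: cvgMl_tmp; exact: cvg_cot_power_sum.
rewrite -(funext finite) => /(cvg_unique _ L) E.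
rewrite -mulrA E // mulr_sumr; apply: eq_bigr => i _; rewrite -/(Z i).
by ring.
Qed.

End Limits.

Theorem corollary1 (R : realType) (k : nat) (hk : (1 <= k)%N) :
  zeta ((2 * k)%:R : R) =
  pi ^+ (2 * k) / 2 *
  ((zetaP R k).[k%:R] / \prod_(1 <= i < k.+1) (odd_dfact i)%:R).
Proof.
case: k hk => // n _; rewrite -/(zetaP_ratio R n.+1).
have := convolution_inj R (fun n => ((2 * n + 1)`!)%:R^-1)
  (fun i => (-1) ^+ i * zetaP_ratio R i.+1)
  (fun i => (-1) ^+ i *
    (2 * (zeta ((2 * i.+1)%:R : R) / pi ^+ (2 * i.+1)))) _ _ n.
rewrite /= muln0 invr1 oner_eq0 => /(_ isT) H.
have /mulfI -> := H (fun m => etrans (zetaP_ratio_convolution R m)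
  (esym (zeta_convolution R m))); last by rewrite signr_eq0.
by field; rewrite expf_neq0// gt_eqF// pi_gt0.
Qed.
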